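(* Let $r,J,K$ be positive integers and let $c_{js},d_{ks}\in\mathbb{Z}_{\ge 0}$ for $1\le j\le J$, $1\le k\le K$, $1\le s\le r$. Put $C_j(x)=\sum_{s=1}^r c_{js}x_s$ and $D_k(x)=\sum_{s=1}^r d_{ks}x_s$ for $x=(x_1,\dots,x_r)$. Assume: no $C_j$ and no $D_k$ is identically zero; $C_j\neq D_k$ for all $j,k$; for each $s$ some $c_{js}\neq 0$ or some $d_{ks}\neq 0$; and $\sum_{j=1}^J c_{js}=\sum_{k=1}^K d_{ks}$ for $s=1,\dots,r$. Define $\Phi(x)=\sum_{j=1}^J\lfloor C_j(x)\rfloor-\sum_{k=1}^K\lfloor D_k(x)\rfloor$ and $\mathcal{D}=\{x\in[0,1)^r : C_j(x)\ge 1 \text{ for some } j \text{ or } D_k(x)\ge 1\text{ for some }k\}$. Let $n=r+J+K$, $N=n+r$, let $\mathbf{a}_1,\dots,\mathbf{a}_n$ be the standard unit basis vectors of $\mathbb{R}^n$, and for $s=1,\dots,r$ let $\mathbf{a}_{n+s}=(e_s,c_{1s},\dots,c_{Js},-d_{1s},\dots,-d_{Ks})\in\mathbb{Z}^n$, where $e_s\in\mathbb{R}^r$ is the $s$-th standard unit vector. Let $C(A)\subseteq\mathbb{R}^n$ be the cone $\{\sum_{i=1}^N z_i\mathbf{a}_i: z_i\ge 0\}$. Then: (a) Every interior lattice point $(u_1,\dots,u_n)\in\mathbb{Z}^n$ of $C(A)$ satisfies $\sum_{i=1}^n u_i\ge J+r$ if and only if $\Phi(x)\ge 0$ for all $x\in[0,1)^r$.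 (b) The point $\sum_{i=1}^{J+r}\mathbf{a}_i=(1,\dots,1,0,\dots,0)$ ($J+r$ ones followed by $K$ zeros) is the unique interior lattice point $(u_1,\dots,u_n)$ of $C(A)$ satisfying $\sum_{i=1}^n u_i<J+r+1$ if and only if $\Phi(x)\ge 1$ for all $x\in\mathcal{D}$.
   Context: $\lfloor\cdot\rfloor$ denotes the floor function. ''Interior'' means the topological interior in $\mathbb{R}^n$. *)

(* Defs.v *)
From mathcomp Require Import all_boot all_order all_algebra.
From mathcomp Require Import all_classical all_reals all_analysis.

Set Implicit Arguments.
Unset Strict Implicit.
Unset Printing Implicit Defensive.

Import Order.TTheory GRing.Theory Num.Theory.
Import numFieldNormedType.Exports.

Local Open Scope classical_set_scope.
Local Open Scope ring_scope.

Section Defs.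
Variables (R : realType) (r J K : nat).
Variables (c : 'I_J -> 'I_r -> nat) (d : 'I_K -> 'I_r -> nat).

Definition linform (w : 'I_r -> nat) (x : 'rV[R]_r) : R :=
  \sum_(s < r) (w s)%:R * x 0 s.

Definition Phi (x : 'rV[R]_r) : int :=
  \sum_(j < J) Num.floor (linform (c j) x)
  - \sum_(k < K) Num.floor (linform (d k) x).

Definition unit_cube : set 'rV[R]_r :=
  [set x | forall s : 'I_r, 0 <= x 0 s < 1].

Definition Dset : set 'rV[R]_r :=
  [set x | unit_cube x /\
    ((exists j : 'I_J, 1 <= linform (c j) x) \/
     (exists k : 'I_K, 1 <= linform (d k) x))].

Definition avec (i : 'I_(r + J + K + r)) : 'rV[R]_(r + J + K) :=
  match fintype.split i with
  | inl i0 => delta_mx 0 i0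
  | inr s => row_mx (row_mx (delta_mx 0 s) (\row_(j < J) (c j s)%:R))
                    (\row_(k < K) - (d k s)%:R)
  end.

Definition coneA : set 'rV[R]_(r + J + K) :=
  [set v | exists z : 'I_(r + J + K + r) -> R,
    (forall i, 0 <= z i) /\ v = \sum_i z i *: avec i].

(* [interior] is taken for the product topology on ['rV[R]_(r + J + K)]. *)
Definition interior_lattice_point (u : 'rV[int]_(r + J + K)) : Prop :=
  interior coneA (map_mx intr u).

Definition special_point : 'rV[int]_(r + J + K) :=
  row_mx (const_mx 1 : 'rV_(r + J)) (const_mx 0 : 'rV_K).

Lemma special_pointE :
  map_mx intr special_point = \sum_(i < r + J + K + r | (i < J + r)%N) avec i.
Proof.
rewrite big_split_ord /= [X in _ + X]big_pred0 ?addr0; last first.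
  by move=> s; rewrite addnC -addnA addnC ltnNge; apply/negbF;
     rewrite (addnC J) -!addnA leq_add2l leq_addr.
apply/rowP => t; rewrite summxE mxE.
under eq_bigr => i _.
  rewrite /avec (_ : fintype.split _ = inl i); last exact: (unsplitK (inl i)).
  rewrite mxE eqxx /=; over.
rewrite /special_point.
case: (ltnP t (r + J)) => ht.
  rewrite (bigD1 t) /=; last by rewrite (addnC J).
  rewrite eqxx big1 ?addr0; last by move=> i /andP[_ /negbTE it]; rewrite eq_sym it.
  rewrite mxE; case: splitP => k tk; rewrite mxE //.
  by move: ht; rewrite tk ltnNge leq_addr.
rewrite big1; last first.
  move=> i hi; case: eqP => // ti.
  by move: hi; rewrite (addnC J) ltnNge -ti ht.
rewrite mxE; case: splitP => k tk; rewrite mxE //.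
by move: ht; rewrite tk leqNgt ltn_ord.
Qed.

End Defs.

(* Main.v *)
Require Import Defs.
From mathcomp Require Import all_boot all_order all_algebra.
From mathcomp Require Import all_classical all_reals all_analysis.
From mathcomp Require Import zify ring.

(** Eliminating the coefficients of the unit vectors, a point [(p, q, w)] is
    interior to the cone iff some [x] satisfies [0 < x_s < p_s],
    [C_j(x) < q_j] and [- D_k(x) < w_k].  For a lattice point this forces
    [p_s >= floor x_s + 1], [q_j >= floor C_j(x) + 1] and
    [w_k >= - floor D_k(x)], so the coordinate sum is at least
    [r + J + \sum_s floor x_s + Phi(x)], where [Phi] is 1-periodic in each
    variable by the balancing condition.  Conversely, each [x] in the unit cube
    yields the interior lattice point
    [(1, floor C_j(x) + 1, - floor D_k(x))], of sum [r + J + Phi(x)]: all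
    strict inequalities hold at [x + e (1, ..., 1)] for small [e > 0]. *)

Set Implicit Arguments.
Unset Strict Implicit.
Unset Printing Implicit Defensive.

Import Order.TTheory GRing.Theory Num.Theory.
Import numFieldNormedType.Exports.

Local Open Scope classical_set_scope.
Local Open Scope ring_scope.

(** Each inequality holds for all small positive [e], and finitely many such conditions hold
    simultaneously near 0 on the right. *)
Lemma exists_small_perturbation (R : realType) (I : finType) (a b t : I -> R) :
  (forall i, a i < t i) ->
  exists2 e : R, 0 < e & forall i, a i + e * b i < t i.
Proof.
move=> lt_at.
suff H : \forall e \near (0 : R)^'+, forall i, a i + e * b i < t i.
  have [e [e0 He]] := filter_ex (filterI (nbhs_right_gt (0 : R)) H).
  by exists e.
apply: filter_forall => i.
(* The added 1 keeps the divisor positive even when [b i] is 0. *)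
have b1 : 0 < `|b i| + 1 by rewrite ltr_wpDl.
have ub : 0 < (t i - a i) / (`|b i| + 1) by rewrite divr_gt0 ?subr_gt0.
near=> e.
have e0 : 0 < e by near: e; exact: nbhs_right_gt.
have : e < (t i - a i) / (`|b i| + 1) by near: e; exact: nbhs_right_lt.
rewrite ltr_pdivlMr // ltrBrDl; apply: le_lt_trans.
rewrite lerD2l ler_pM2l //.
by rewrite (le_trans (ler_norm _)) // lerDl.
Unshelve. all: by end_near. Qed.

(** * Linear forms, their floors, and periodicity of [Phi] *)

Lemma linformD (R : realType) (r : nat) (w : 'I_r -> nat) (x y : 'rV[R]_r) :
  linform w (x + y) = linform w x + linform w y.
Proof.
by rewrite /linform -big_split /=; apply: eq_bigr => s _; rewrite mxE mulrDr.
Qed.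

Lemma linformZ (R : realType) (r : nat) (w : 'I_r -> nat) (a : R)
    (x : 'rV[R]_r) :
  linform w (a *: x) = a * linform w x.
Proof.
by rewrite /linform mulr_sumr; apply: eq_bigr => s _; rewrite mxE mulrCA.
Qed.

Lemma linform_ge0 (R : realType) (r : nat) (w : 'I_r -> nat) (x : 'rV[R]_r) :
  (forall s, 0 <= x 0 s) -> 0 <= linform w x.
Proof. by move=> x0; apply: sumr_ge0 => s _; rewrite mulr_ge0. Qed.

Lemma floor_linform_eq0 (R : realType) (r : nat) (w : 'I_r -> nat)
    (x : 'rV[R]_r) :
  (forall s, 0 <= x 0 s) -> linform w x < 1 -> Num.floor (linform w x) = 0.
Proof.
move=> x0 lt1; apply/eqP.
by rewrite eq_le floor_le0 lt1 floor_ge0 linform_ge0.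
Qed.

(** The value at the all-ones vector is the sum of the natural coefficients, so it vanishes only if
    every coefficient does. *)
Lemma linform1_gt0 (R : realType) (r : nat) (w : 'I_r -> nat) :
  ~ (forall x : 'rV[R]_r, linform w x = 0) ->
  0 < linform w (const_mx 1 : 'rV[R]_r).
Proof.
move=> w_neq0; rewrite lt_def linform_ge0 ?andbT; last by move=> s; rewrite mxE.
apply: contra_notN w_neq0 => /eqP w1 x; apply: big1 => s _.
suff -> : (w s)%:R = 0 :> R by rewrite mul0r.
have := w1; rewrite /linform (eq_bigr (fun s => (w s)%:R)); last first.
  by move=> i _; rewrite mxE mulr1.
by move/psumr_eq0P => -> // i _; rewrite ler0n.
Qed.

(** The coefficients are integers, so the integer parts of the coordinates contribute an integer,
    which comes out of the floor. *)
Lemma floor_linform (R : realType) (r : nat) (w : 'I_r -> nat)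
    (x : 'rV[R]_r) :
  Num.floor (linform w x) = \sum_s (w s)%:Z * Num.floor (x 0 s)
    + Num.floor (linform w (\row_s (x 0 s - (Num.floor (x 0 s))%:~R))).
Proof.
have -> : linform w x = (\sum_s (w s)%:Z * Num.floor (x 0 s))%:~R
    + linform w (\row_s (x 0 s - (Num.floor (x 0 s))%:~R)).
  rewrite /linform rmorph_sum -big_split /=; apply: eq_bigr => s _.
  by rewrite mxE mulrBr intrM addrC subrK.
by rewrite floorDzr ?intr_int // intrKfloor.
Qed.

Lemma Phi_frac (R : realType) (r J K : nat)
    (c : 'I_J -> 'I_r -> nat) (d : 'I_K -> 'I_r -> nat) (x : 'rV[R]_r) :
  (forall s, (\sum_(j < J) c j s)%N = (\sum_(k < K) d k s)%N) ->
  Phi c d (\row_s (x 0 s - (Num.floor (x 0 s))%:~R)) = Phi c d x.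
Proof.
move=> balanced; rewrite /Phi.
under [in RHS]eq_bigr => j _ do rewrite floor_linform.
under [X in _ = _ - X]eq_bigr => k _ do rewrite floor_linform.
(* After exchanging the sums, the coefficient of each [Num.floor (x 0 s)] is a column sum of [c] or
   of [d]; these agree by [balanced] and cancel. *)
rewrite !big_split /= [X in _ = X + _ - _]exchange_big /=.
rewrite [X in _ = _ - (X + _)]exchange_big /=.
have -> : \sum_(s < r) \sum_(j < J) (c j s)%:Z * Num.floor (x 0 s)
        = \sum_(s < r) \sum_(k < K) (d k s)%:Z * Num.floor (x 0 s).
  apply: eq_bigr => s _; rewrite -!mulr_suml -!(big_morph Posz PoszD erefl).
  by rewrite balanced.
by rewrite opprD addrACA subrr add0r.
Qed.

Lemma unit_cube_frac (R : realType) (r : nat) (x : 'rV[R]_r) :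
  unit_cube (\row_s (x 0 s - (Num.floor (x 0 s))%:~R)).
Proof.
move=> s; rewrite mxE subr_ge0 floor_le /= ltrBlDl.
by have := floorD1_gt (x 0 s); rewrite intrD.
Qed.

(** * The cone and its interior as systems of inequalities *)

Definition cone_bound (R : realType) (r J K : nat)
    (c : 'I_J -> 'I_r -> nat) (d : 'I_K -> 'I_r -> nat) (x : 'rV[R]_r) :
    'rV[R]_(r + J + K) :=
  row_mx (row_mx x (\row_j linform (c j) x)) (\row_k - linform (d k) x).

Lemma forall_ord_split3 (r J K : nat) (P : 'I_(r + J + K) -> Prop) :
  (forall s, P (lshift K (lshift J s))) ->
  (forall j, P (lshift K (rshift r j))) ->
  (forall k, P (rshift (r + J) k)) -> forall i, P i.
Proof.
move=> Pr PJ PK i; case: (split_ordP i) => [i' ->|k -> //].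
by case: (split_ordP i') => [s ->|j ->].
Qed.

Lemma cone_bound_addZ (R : realType) (r J K : nat)
    (c : 'I_J -> 'I_r -> nat) (d : 'I_K -> 'I_r -> nat)
    (x y : 'rV[R]_r) (a : R) :
  cone_bound c d (x + a *: y) = cone_bound c d x + a *: cone_bound c d y.
Proof.
apply/rowP; apply: forall_ord_split3 => i;
  rewrite /cone_bound [RHS]mxE [X in _ = _ + X]mxE.
- by rewrite !row_mxEl !mxE.
- by rewrite !(row_mxEl, row_mxEr) !mxE linformD linformZ.
- by rewrite !row_mxEr !mxE linformD linformZ opprD mulrN.
Qed.

(** [cone_bound c d x] is the combination of the last [r] generators with coefficients [x]; the
    others are the unit vectors, so their coefficients are simply added coordinatewise. *)
Lemma lincomb_avec (R : realType) (r J K : nat)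
    (c : 'I_J -> 'I_r -> nat) (d : 'I_K -> 'I_r -> nat)
    (z : 'I_(r + J + K + r) -> R) :
  \sum_i z i *: avec R c d i
  = \row_i z (lshift r i) + cone_bound c d (\row_s z (rshift (r + J + K) s)).
Proof.
rewrite big_split_ord /=; congr (_ + _).
  rewrite [RHS]row_sum_delta; apply: eq_bigr => i _.
  by rewrite /avec (unsplitK (inl i)) mxE.
under eq_bigr => s _ do rewrite /avec (unsplitK (inr s)).
apply/rowP; apply: forall_ord_split3 => i; rewrite /cone_bound summxE.
- rewrite !row_mxEl mxE (bigD1 i) //= big1 ?addr0.
    by rewrite mxE !row_mxEl mxE !eqxx mulr1.
  by move=> s /negbTE si; rewrite mxE !row_mxEl mxE eq_sym si andbF mulr0.
- rewrite row_mxEl row_mxEr mxE /linform; apply: eq_bigr => s _.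
  by rewrite [LHS]mxE row_mxEl row_mxEr !mxE mulrC.
- rewrite row_mxEr mxE /linform -sumrN; apply: eq_bigr => s _.
  by rewrite [LHS]mxE row_mxEr !mxE mulrN mulrC.
Qed.

(** Once the coefficients [x] of the last [r] generators are chosen, those of the unit vectors are
    forced to be the slacks [v - cone_bound c d x], so only their signs matter. *)
Lemma coneAP (R : realType) (r J K : nat)
    (c : 'I_J -> 'I_r -> nat) (d : 'I_K -> 'I_r -> nat)
    (v : 'rV[R]_(r + J + K)) :
  coneA c d v <-> exists x : 'rV[R]_r, (forall s, 0 <= x 0 s) /\
    forall i, cone_bound c d x 0 i <= v 0 i.
Proof.
split=> [[z [z0 ->]]|[x [x0 xv]]].
  exists (\row_s z (rshift (r + J + K) s)); split=> [s|i]; first by rewrite mxE.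
  by rewrite lincomb_avec [leRHS]mxE lerDr mxE.
exists (fun i => match fintype.split i with
  | inl i0 => v 0 i0 - cone_bound c d x 0 i0 | inr s => x 0 s end).
split=> [i|]; first by case: fintype.split => // i0; rewrite subr_ge0.
rewrite lincomb_avec; apply/rowP => i; rewrite 2!mxE (unsplitK (inl i)).
rewrite (_ : \row_s _ = x) ?subrK //.
by apply/rowP => s; rewrite mxE (unsplitK (inr s)).
Qed.

Lemma interior_coneAP (R : realType) (r J K : nat)
    (c : 'I_J -> 'I_r -> nat) (d : 'I_K -> 'I_r -> nat)
    (v : 'rV[R]_(r + J + K)) :
  interior (coneA c d) v <-> exists x : 'rV[R]_r, (forall s, 0 < x 0 s) /\
    forall i, cone_bound c d x 0 i < v 0 i.
Proof.
split=> [/nbhs_ballP[e /= e0 ev]|[x [x0 xv]]].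
  (* [w] is the sum of all generators: subtracting a small multiple of it
     stays in the cone, so all inequalities have some slack. *)
  pose w := cone_bound c d (const_mx 1 : 'rV[R]_r) + const_mx 1.
  have [a a0 aw] := @exists_small_perturbation R _ (fun=> 0)
    (fun i => `|w 0 i|) (fun=> e) (fun=> e0).
  have /ev/coneAP[x [x0 xv]] : ball v e (v - a *: w).
    split=> // i j; rewrite ord1 /ball /= !mxE opprD opprK addNKr.
    by have := aw j; rewrite add0r normrM (gtr0_norm a0) !mxE.
  (* The first summand of [w] pays for shifting [x] by [a] in every coordinate, which makes it
     positive; the second leaves slack [a] in every inequality. *)
  exists (x + a *: const_mx 1); split=> [s|i].
    by rewrite !mxE mulr1 ltr_wpDl.
  have := xv i; rewrite cone_bound_addZ /w.
  move: (cone_bound c d x) (cone_bound c d _) => p q; rewrite !mxE.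
  rewrite mulrDr mulr1 opprD addrA !lerBrDr addrAC => /(lt_le_trans _); apply.
  by rewrite ltrDl.
(* The same [x] serves all nearby [v']: finitely many strict inequalities on continuous coordinates
   are an open condition. *)
rewrite /interior; near=> v'; apply/coneAP; exists x; split=> [s|i].
  exact: ltW.
apply/ltW; move: i; near: v'; apply: filter_forall => i.
have /(_ [set y | cone_bound c d x 0 i < y]) := @coord_continuous R 1 _ 0 i v.
by apply; exact: lt_nbhsr.
Unshelve. all: by end_near. Qed.

(** * Interior lattice points and their coordinate sums *)

Lemma sum_ord_split3 (r J K : nat) (u : 'rV[int]_(r + J + K)) :
  \sum_i u 0 i = \sum_s u 0 (lshift K (lshift J s))
    + \sum_j u 0 (lshift K (rshift r j)) + \sum_k u 0 (rshift (r + J) k).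
Proof. by rewrite !big_split_ord. Qed.

Lemma interior_lattice_pointP (R : realType) (r J K : nat)
    (c : 'I_J -> 'I_r -> nat) (d : 'I_K -> 'I_r -> nat)
    (u : 'rV[int]_(r + J + K)) :
  interior_lattice_point R c d u <-> exists x : 'rV[R]_r,
    [/\ forall s, 0 < x 0 s < (u 0 (lshift K (lshift J s)))%:~R,
        forall j, linform (c j) x < (u 0 (lshift K (rshift r j)))%:~R
      & forall k, - linform (d k) x < (u 0 (rshift (r + J) k))%:~R].
Proof.
rewrite /interior_lattice_point; split.
  move=> /interior_coneAP[x [x0 xu]]; exists x; split=> [s|j|k].
  - by rewrite x0; have := xu (lshift K (lshift J s)); rewrite !row_mxEl !mxE.
  - by have := xu (lshift K (rshift r j)); rewrite row_mxEl row_mxEr !mxE.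
  - by have := xu (rshift (r + J) k); rewrite row_mxEr !mxE.
move=> [x [xs xj xk]]; apply/interior_coneAP; exists x; split=> [s|].
  by case/andP: (xs s).
apply: forall_ord_split3 => i.
- by rewrite !row_mxEl !mxE; case/andP: (xs i).
- by rewrite row_mxEl row_mxEr !mxE.
- by rewrite row_mxEr !mxE.
Qed.

Lemma sum_interior_ge (R : realType) (r J K : nat)
    (c : 'I_J -> 'I_r -> nat) (d : 'I_K -> 'I_r -> nat)
    (u : 'rV[int]_(r + J + K)) (x : 'rV[R]_r) :
  (forall s, 0 < x 0 s < (u 0 (lshift K (lshift J s)))%:~R) ->
  (forall j, linform (c j) x < (u 0 (lshift K (rshift r j)))%:~R) ->
  (forall k, - linform (d k) x < (u 0 (rshift (r + J) k))%:~R) ->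
  (J + r)%:Z + \sum_s Num.floor (x 0 s) + Phi c d x <= \sum_i u 0 i.
Proof.
move=> xs xj xk.
have -> : (J + r)%:Z + \sum_s Num.floor (x 0 s) + Phi c d x =
    \sum_s (Num.floor (x 0 s) + 1) + \sum_j (Num.floor (linform (c j) x) + 1)
    - \sum_k Num.floor (linform (d k) x).
  rewrite !big_split /= !sumr_const !card_ord /Phi PoszD.
  rewrite !natz.
  ring.
rewrite sum_ord_split3 -sumrN !lerD //; apply: ler_sum => i _.
- by rewrite lezD1 floor_lt_int; case/andP: (xs i).
- by rewrite lezD1 floor_lt_int.
(* No unit is gained in this block: if [linform (d k) x] is not an integer, [- floor] is already its
   negative rounded up. Hence the constant [J + r], counting the other two blocks only. *)
- by rewrite lerNl floor_ge_int rmorphN /= lerNl ltW.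
Qed.

Definition floor_point (R : realType) (r J K : nat)
    (c : 'I_J -> 'I_r -> nat) (d : 'I_K -> 'I_r -> nat) (x : 'rV[R]_r) :
    'rV[int]_(r + J + K) :=
  row_mx (row_mx (const_mx 1) (\row_j (Num.floor (linform (c j) x) + 1)))
         (\row_k - Num.floor (linform (d k) x)).

Lemma sum_floor_point (R : realType) (r J K : nat)
    (c : 'I_J -> 'I_r -> nat) (d : 'I_K -> 'I_r -> nat) (x : 'rV[R]_r) :
  \sum_i floor_point c d x 0 i = (J + r)%:Z + Phi c d x.
Proof.
rewrite sum_ord_split3 /floor_point.
under eq_bigr do rewrite !row_mxEl mxE.
under [X in _ + X + _]eq_bigr do rewrite row_mxEl row_mxEr mxE.
under [X in _ + X]eq_bigr do rewrite row_mxEr mxE.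
rewrite big_split /= !sumr_const !card_ord sumrN /Phi PoszD !natz.
ring.
Qed.

Lemma floor_point_interior (R : realType) (r J K : nat)
    (c : 'I_J -> 'I_r -> nat) (d : 'I_K -> 'I_r -> nat) (x : 'rV[R]_r) :
  (forall k, ~ (forall y : 'rV[R]_r, linform (d k) y = 0)) ->
  unit_cube x -> interior_lattice_point R c d (floor_point c d x).
Proof.
move=> D_neq0 cube_x.
(* Only the first two blocks need [e] small, as their inequalities are strict at [x] itself. Those
   of the last block may be equalities at [x] and become strict for any [e > 0], since
   [linform (d k)] is positive at the all-ones vector. *)
pose a (i : 'I_r + 'I_J) :=
  match i with inl s => x 0 s | inr j => linform (c j) x end.
pose b (i : 'I_r + 'I_J) : R :=
  match i with inl s => 1 | inr j => linform (c j) (const_mx 1) end.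
pose t (i : 'I_r + 'I_J) : R := match i with inl s => 1
  | inr j => (Num.floor (linform (c j) x) + 1)%:~R end.
have [|e e0 lt_t] := @exists_small_perturbation R _ a b t.
  by move=> [s|j]; [case/andP: (cube_x s) | exact: floorD1_gt].
apply/interior_lattice_pointP; exists (x + e *: const_mx 1); split=> [s|j|k].
- rewrite !row_mxEl !mxE mulr1; case/andP: (cube_x s) => x0 _.
  by rewrite ltr_wpDl //=; have := lt_t (inl s); rewrite /a /b mulr1.
- rewrite row_mxEl row_mxEr mxE linformD linformZ.
  exact: (lt_t (inr j)).
- rewrite row_mxEr mxE linformD linformZ rmorphN /= ltrN2.
  apply: (le_lt_trans (floor_le _)).
  by rewrite ltrDl mulr_gt0 // linform1_gt0.
Qed.

Lemma floor_point_special (R : realType) (r J K : nat)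
    (c : 'I_J -> 'I_r -> nat) (d : 'I_K -> 'I_r -> nat) (x : 'rV[R]_r) :
  (forall s, 0 <= x 0 s) ->
  floor_point c d x = special_point r J K <->
  (forall j, linform (c j) x < 1) /\ (forall k, linform (d k) x < 1).
Proof.
move=> x0; split.
  move=> /rowP E; split=> i.
    have := E (lshift K (rshift r i)); rewrite !row_mxEl row_mxEr !mxE => /eqP.
    by rewrite -subr_eq0 addrK => /eqP fl0; rewrite -floor_le0 fl0.
  have := E (rshift (r + J) i); rewrite !row_mxEr !mxE => /eqP.
  by rewrite oppr_eq0 => /eqP fl0; rewrite -floor_le0 fl0.
move=> [cx dx]; apply/rowP; apply: forall_ord_split3 => i.
- by rewrite !row_mxEl !mxE.
- by rewrite !row_mxEl row_mxEr !mxE floor_linform_eq0.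
- by rewrite !row_mxEr !mxE floor_linform_eq0 // oppr0.
Qed.

Lemma notin_Dset (R : realType) (r J K : nat)
    (c : 'I_J -> 'I_r -> nat) (d : 'I_K -> 'I_r -> nat) (x : 'rV[R]_r) :
  unit_cube x -> ~ Dset c d x ->
  (forall j, linform (c j) x < 1) /\ (forall k, linform (d k) x < 1).
Proof.
move=> cube_x nDx; split=> i; rewrite ltNge; apply/negP => ge1; apply: nDx.
  by split=> //; left; exists i.
by split=> //; right; exists i.
Qed.

Lemma Phi_notin_Dset (R : realType) (r J K : nat)
    (c : 'I_J -> 'I_r -> nat) (d : 'I_K -> 'I_r -> nat) (x : 'rV[R]_r) :
  unit_cube x -> ~ Dset c d x -> Phi c d x = 0.
Proof.
move=> cube_x /(notin_Dset cube_x)[cx dx].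
have x0 s : 0 <= x 0 s by case/andP: (cube_x s).
by rewrite /Phi !big1 ?subr0 // => i _; rewrite floor_linform_eq0.
Qed.


Theorem theorem2p1 (R : realType) (r J K : nat)
    (r_gt0 : (0 < r)%N) (J_gt0 : (0 < J)%N) (K_gt0 : (0 < K)%N)
    (c : 'I_J -> 'I_r -> nat) (d : 'I_K -> 'I_r -> nat)
    (C_neq0 : forall j : 'I_J, ~ (forall x : 'rV[R]_r, linform (c j) x = 0))
    (D_neq0 : forall k : 'I_K, ~ (forall x : 'rV[R]_r, linform (d k) x = 0))
    (C_neq_D : forall (j : 'I_J) (k : 'I_K),
       ~ (forall x : 'rV[R]_r, linform (c j) x = linform (d k) x))
    (x_occurs : forall s : 'I_r,
       (exists j : 'I_J, c j s <> 0%N) \/ (exists k : 'I_K, d k s <> 0%N))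
    (balanced : forall s : 'I_r,
       (\sum_(j < J) c j s)%N = (\sum_(k < K) d k s)%N) :
  ((forall u : 'rV[int]_(r + J + K), interior_lattice_point R c d u ->
      (J + r)%:Z <= \sum_i u 0 i)
   <-> (forall x : 'rV[R]_r, unit_cube x -> 0 <= Phi c d x))
  /\
  ((forall u : 'rV[int]_(r + J + K),
      (interior_lattice_point R c d u /\ \sum_i u 0 i < (J + r + 1)%:Z)
      <-> u = special_point r J K)
   <-> (forall x : 'rV[R]_r, Dset c d x -> 1 <= Phi c d x)).
Proof.
have floors_ge0 (x : 'rV[R]_r) : (forall s, 0 < x 0 s) ->
    0 <= \sum_s Num.floor (x 0 s).
  by move=> x0; apply: sumr_ge0 => s _; rewrite floor_ge0 ltW.
have partA : (forall x : 'rV[R]_r, unit_cube x -> 0 <= Phi c d x) ->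
    forall u, interior_lattice_point R c d u -> (J + r)%:Z <= \sum_i u 0 i.
  move=> Phi_ge0 u /interior_lattice_pointP[x [xs xj xk]].
  apply: le_trans (sum_interior_ge xs xj xk).
  rewrite -addrA lerDl addr_ge0 //.
    by apply: floors_ge0 => s; case/andP: (xs s).
  (* The witness [x] may lie outside the unit cube; periodicity moves it there. *)
  by rewrite -(Phi_frac _ balanced) Phi_ge0 //; exact: unit_cube_frac.
split; split; [|exact: partA| |].
- move=> H x Hx; have := H _ (floor_point_interior c D_neq0 Hx).
  by rewrite sum_floor_point lerDl.
- move=> H x [cube_x Dx]; rewrite leNgt; apply/negP => Phi_lt1.
  have x0 s : 0 <= x 0 s by case/andP: (cube_x s).
  (* If [Phi c d x < 1], uniqueness forces the floor point of [x] to be the special point, so every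
     form is below 1 at [x], against membership in [Dset]. *)
  have /H/(floor_point_special _ _ x0)[cx dx] :
      interior_lattice_point R c d (floor_point c d x) /\
      \sum_i floor_point c d x 0 i < (J + r + 1)%:Z.
    split; first exact: floor_point_interior.
    by rewrite sum_floor_point [ltRHS]PoszD ltrD2l.
  by case: Dx => -[i]; rewrite leNgt ?cx ?dx.
- move=> Phi_ge1.
  have Phi_ge0 (x : 'rV[R]_r) : unit_cube x -> 0 <= Phi c d x.
    move=> cube_x; have [Dx|nDx] := pselect (Dset c d x).
      exact: le_trans (Phi_ge1 x Dx).
    by rewrite Phi_notin_Dset.
  move=> u; split=> [[/interior_lattice_pointP[x [xs xj xk]] u_lt]|->]; last first.
    (* The special point is the floor point of the origin, where all forms vanish. *)
    pose o : 'rV[R]_r := 0.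
    have o0 s : 0 <= o 0 s by rewrite mxE.
    have cube_o : unit_cube o by move=> s; rewrite mxE lexx ltr01.
    have lin_o w : linform w o = 0.
      by apply: big1 => s _; rewrite mxE mulr0.
    have <- : floor_point c d o = special_point r J K.
      by apply/floor_point_special => //; split=> i; rewrite lin_o ltr01.
    split; first exact: floor_point_interior.
    rewrite sum_floor_point Phi_notin_Dset ?addr0 ?ltz_nat ?addn1 //.
    by case=> _ [] [i]; rewrite lin_o ler10.
  have x0 s : 0 < x 0 s by case/andP: (xs s).
  have sum_u : \sum_i u 0 i <= (J + r)%:Z.
    by move: u_lt; rewrite PoszD ltzD1.
  have Phi_x : 0 <= Phi c d x.
    by rewrite -(Phi_frac _ balanced); apply/Phi_ge0/unit_cube_frac.
  (* The floor sum and [Phi c d x] are both nonnegative with sum at most 0, so both vanish: the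
     first puts [x] in the unit cube, the second keeps it out of [Dset]. *)
  have := le_trans (sum_interior_ge xs xj xk) sum_u.
  rewrite -addrA gerDl => le0.
  have fl_x : \sum_s Num.floor (x 0 s) = 0.
    by have := floors_ge0 _ x0; lia.
  have cube_x : unit_cube x.
    move=> s; rewrite ltW //= -floor_le0.
    suff -> : Num.floor (x 0 s) = 0 by [].
    move/psumr_eq0P: fl_x; apply=> // i _.
    by rewrite floor_ge0 ltW.
  have /(notin_Dset cube_x)[cx dx] : ~ Dset c d x.
    by move/Phi_ge1; lia.
  (* Integrality now bounds [u] below by the special point in each coordinate; in the last block,
     [linform (d k) x < 1] gives an entry above -1. As the sum of [u] is at most [J + r], that of
     the special point, the two coincide. *)
  have ups s : 1 <= u 0 (lshift K (lshift J s)).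
    by case/andP: (xs s) => _; rewrite -gtz0_ge1 -(ltr0z R); apply: lt_trans.
  have upj j : 1 <= u 0 (lshift K (rshift r j)).
    rewrite -gtz0_ge1 -(ltr0z R); apply: le_lt_trans (xj j).
    by apply: linform_ge0 => s; exact: ltW.
  have upk k : 0 <= u 0 (rshift (r + J) k).
    rewrite -ltzD1 -(ltr0z R) intrD -ltrBlDr sub0r.
    by apply: lt_trans (xk k); rewrite ltrN2.
  have le_u i : special_point r J K 0 i <= u 0 i.
    move: i; apply: forall_ord_split3 => i.
    - by rewrite /special_point row_mxEl mxE.
    - by rewrite /special_point row_mxEl mxE.
    - by rewrite /special_point row_mxEr mxE.
  have sum_sp : \sum_i special_point r J K 0 i = (J + r)%:Z.
    rewrite sum_ord_split3 /special_point.
    under eq_bigr do rewrite row_mxEl mxE.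
    under [X in _ + X + _]eq_bigr do rewrite row_mxEl mxE.
    under [X in _ + X]eq_bigr do rewrite row_mxEr mxE.
    by rewrite !sumr_const !card_ord mul0rn addr0 !natz PoszD addrC.
  apply/rowP => i; apply/eqP; rewrite -subr_eq0; apply/eqP; move: i.
  have : \sum_i (u 0 i - special_point r J K 0 i) = 0.
    apply/eqP; rewrite eq_le sumr_ge0 ?andbT => [|i _]; last by rewrite subr_ge0.
    by rewrite sumrB sum_sp subr_le0.
  by move/psumr_eq0P => E i; apply: E => // k _; rewrite subr_ge0.
Qed.
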